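(* Let $n\ge2$, let $\alpha_1,\dots,\alpha_n$ be picture fuzzy numbers, let $\omega=(\omega_1,\dots,\omega_n)^{\mathrm T}$ be their weight vector with $\omega_i\in(0,1]$ and $\sum_{i=1}^n\omega_i=1$, and let $T$ be a strict t-norm. If all $\alpha_i$ are equal, i.e. $\alpha_i=\alpha$ for all $i=1,\dots,n$, then for all $p,q>0$, $$\mathrm{PFINWBM}_T^{p,q}(\alpha_1,\dots,\alpha_n)=\alpha.$$
   Context: A picture fuzzy number (PFN) is a triple $\alpha=\langle\mu,\eta,\nu\rangle$ with $\mu,\eta,\nu\in[0,1]$ and $\mu+\eta+\nu\le1$. A t-norm is a commutative, associative map $T:[0,1]^2\to[0,1]$, nondecreasing in each variable, with $T(1,x)=x$. It is strict if it is continuous and $T(x,y)<T(x,z)$ whenever $x>0$ and $y<z$. A strict t-norm has a continuous additive generator: a continuous strictly decreasing bijection $\tau:[0,1]\to[0,+\infty]$ with $\tau(1)=0$, $\tau(0)=+\infty$ and $T(x,y)=\tau^{-1}(\tau(x)+\tau(y))$. Its dual t-conorm is $S(x,y)=1-T(1-x,1-y)=\zeta^{-1}(\zeta(x)+\zeta(y))$, where $\zeta(x)=\tau(1-x)$. Arithmetic in $[0,+\infty]$ is the usual one ($a+\infty=\infty$, $\lambda\cdot\infty=\infty$ for $\lambda>0$). For a strict t-norm $T$, PFNs $\alpha_k=\langle\mu_k,\eta_k,\nu_k\rangle$ ($k=1,2$), $\alpha=\langle\mu,\eta,\nu\rangle$ and $\lambda>0$ define: $\alpha_1\oplus\alpha_2=\langle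 S(\mu_1,\mu_2),\,T(\eta_1+\nu_1,\eta_2+\nu_2)-T(\nu_1,\nu_2),\,T(\nu_1,\nu_2)\rangle$; $\alpha_1\otimes\alpha_2=\langle T(\mu_1,\mu_2),\,T(\eta_1+\mu_1,\eta_2+\mu_2)-T(\mu_1,\mu_2),\,S(\nu_1,\nu_2)\rangle$; $\lambda\cdot\alpha=\langle\zeta^{-1}(\lambda\zeta(\mu)),\,\tau^{-1}(\lambda\tau(\eta+\nu))-\tau^{-1}(\lambda\tau(\nu)),\,\tau^{-1}(\lambda\tau(\nu))\rangle$; $\alpha^\lambda=\langle\tau^{-1}(\lambda\tau(\mu)),\,\tau^{-1}(\lambda\tau(\eta+\mu))-\tau^{-1}(\lambda\tau(\mu)),\,\zeta^{-1}(\lambda\zeta(\nu))\rangle$. These operations send PFNs to PFNs, and $\oplus,\otimes$ are commutative and associative (known facts), so iterated $\bigoplus$ is well defined. For $p,q>0$ the picture fuzzy interactional normalized weighted Bonferroni mean induced by $T$ (with weight vector $\omega$) is $$\mathrm{PFINWBM}_T^{p,q}(\alpha_1,\dots,\alpha_n)=\Big[\bigoplus_{i,j=1,\ i\ne j}^n\tfrac{\omega_i\omega_j}{1-\omega_i}\cdot(\alpha_i^p\otimes\alpha_j^q)\Big]^{\frac1{p+q}}.$$ *)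

(* Defs.v *)
From HB Require Import structures.
From mathcomp Require Import all_boot all_order all_algebra.
From mathcomp Require Import all_classical all_reals all_analysis.
From mathcomp Require Import ring lra.

Set Implicit Arguments.
Unset Strict Implicit.
Unset Printing Implicit Defensive.

Import Order.TTheory GRing.Theory Num.Theory.
Import numFieldNormedType.Exports.

Local Open Scope classical_set_scope.
Local Open Scope ring_scope.

Record triple (R : realType) : Type := Triple { mu : R; eta : R; nu : R }.

Definition is_pfn (R : realType) (a : triple R) : Prop :=
  [/\ mu a \in `[0, 1], eta a \in `[0, 1], nu a \in `[0, 1]
    & mu a + eta a + nu a <= 1].

(* Maps on [0,1] or [0,1]^2 are functions on R whose values outside are
   irrelevant: every condition is restricted to the unit interval, and the
   operations below evaluate them only there when applied to PFNs. *)
Definition tnorm (R : realType) (T : R -> R -> R) : Prop :=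
  [/\ {in `[0, 1] &, forall x y, T x y \in `[0, 1]},
      {in `[0, 1] &, commutative T},
      {in `[0, 1] & &, associative T},
      (forall x x' y y' : R,
        x \in `[0, 1] -> x' \in `[0, 1] -> y \in `[0, 1] -> y' \in `[0, 1] ->
        x <= x' -> y <= y' -> T x y <= T x' y')
    & {in `[0, 1], forall x, T 1 x = x}].

Definition strict_tnorm (R : realType) (T : R -> R -> R) : Prop :=
  [/\ tnorm T,
      {within (`[0, 1] `*` `[0, 1])%classic,
        continuous (fun z : R * R => T z.1 z.2)}
    & {in `[0, 1] & &, forall x y z, 0 < x -> y < z -> T x y < T x z}].

Definition tconorm (R : realType) (T : R -> R -> R) (x y : R) : R :=
  1 - T (1 - x) (1 - y).

Definition zeta (R : realType) (tau : R -> \bar R) (x : R) : \bar R :=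
  tau (1 - x).

(* Inverse of f : [0,1] -> [0,+oo]. *)
Definition unit_inv (R : realType) (f : R -> \bar R) : \bar R -> R :=
  'pinv_(fun=> 0) `[0, 1]%classic f.

Definition additive_generator (R : realType) (T : R -> R -> R)
    (tau : R -> \bar R) : Prop :=
  [/\ {within `[0, 1]%classic, continuous tau},
      {in `[0, 1] &, forall x y, x < y -> (tau y < tau x)%E},
      set_bij `[0, 1]%classic [set y : \bar R | (0 <= y)%E] tau,
      tau 1 = 0%E /\ tau 0 = +oo%E
    & {in `[0, 1] &, forall x y, T x y = unit_inv tau (tau x + tau y)%E}].

Definition pf_add (R : realType) (T : R -> R -> R) (a b : triple R) : triple R :=
  Triple (tconorm T (mu a) (mu b))
         (T (eta a + nu a) (eta b + nu b) - T (nu a) (nu b))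
         (T (nu a) (nu b)).

Definition pf_mul (R : realType) (T : R -> R -> R) (a b : triple R) : triple R :=
  Triple (T (mu a) (mu b))
         (T (eta a + mu a) (eta b + mu b) - T (mu a) (mu b))
         (tconorm T (nu a) (nu b)).

(* The scalar multiple and the power do not depend on the choice of the
   additive generator tau of T. *)
Definition pf_scale (R : realType) (tau : R -> \bar R) (l : R) (a : triple R) :
    triple R :=
  Triple (unit_inv (zeta tau) (l%:E * zeta tau (mu a))%E)
         (unit_inv tau (l%:E * tau (eta a + nu a)%R)%E
          - unit_inv tau (l%:E * tau (nu a))%E)
         (unit_inv tau (l%:E * tau (nu a))%E).

Definition pf_pow (R : realType) (tau : R -> \bar R) (a : triple R) (l : R) :
    triple R :=
  Triple (unit_inv tau (l%:E * tau (mu a))%E)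
         (unit_inv tau (l%:E * tau (eta a + mu a)%R)%E
          - unit_inv tau (l%:E * tau (mu a))%E)
         (unit_inv (zeta tau) (l%:E * zeta tau (nu a))%E).

(* Neutral element of pf_add on PFNs; it only serves as the initial value of
   the iterated sum. *)
Definition pf_zero (R : realType) : triple R := Triple 0 0 1.

Lemma pf_addr0 (R : realType) (T : R -> R -> R) (a : triple R) :
  tnorm T -> is_pfn a -> pf_add T a (pf_zero R) = a.
Proof.
case: a => m e v [_ Tc _ _ T1] [/=]; rewrite !in_itv /= => hm he hv h.
have T1r x : 0 <= x <= 1 -> T x 1 = x.
  by move=> hx; rewrite Tc ?T1// in_itv /= ?ler01 ?lexx.
rewrite /pf_add /tconorm /= subr0 add0r !T1r; [|lra..].
by congr Triple; lra.
Qed.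

Definition PFINWBM (R : realType) (T : R -> R -> R) (tau : R -> \bar R)
    (p q : R) (n : nat) (omega : 'I_n -> R) (alpha : 'I_n -> triple R) :
    triple R :=
  pf_pow tau
    (\big[pf_add T/pf_zero R]_(ij : 'I_n * 'I_n | ij.1 != ij.2)
       pf_scale tau (omega ij.1 * omega ij.2 / (1 - omega ij.1))
         (pf_mul T (pf_pow tau (alpha ij.1) p) (pf_pow tau (alpha ij.2) q)))
    (1 / (p + q)).

(* Main.v *)
Require Import Defs.
From mathcomp Require Import all_boot all_order all_algebra.
From mathcomp Require Import all_classical all_reals all_analysis.
From mathcomp Require Import lra.

Set Implicit Arguments.
Unset Strict Implicit.
Unset Printing Implicit Defensive.

Import Order.TTheory GRing.Theory Num.Theory.
Import numFieldNormedType.Exports.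

Local Open Scope ring_scope.

(** Write [x^(l)] for the [l]-th power [tau^-1 (l * tau x)] of [x] with respect
    to [T]; then [T (x^(l)) (x^(k)) = x^(l+k)] and [(x^(k))^(l) = x^(l*k)].  In
    the coordinates [mu], [eta + mu], [1 - nu] of a PFN, the power of PFNs acts
    as this power and [pf_mul] acts as [T], so [a^p (x) a^q = a^(p+q)].
    Exchanging [mu] and [nu] turns powers into scalar multiples and [pf_mul]
    into [pf_add], so the iterated sum is [c . a^(p+q)], where
    [c = sum_(i != j) w_i w_j / (1 - w_i) = sum_i w_i = 1]. *)

(** * Additive generators and their inverses *)

Lemma additive_generator_inj (R : realType) (T : R -> R -> R)
    (tau : R -> \bar R) (x y : R) :
  additive_generator T tau -> 0 <= x <= 1 -> 0 <= y <= 1 ->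
  tau x = tau y -> x = y.
Proof.
case=> _ _ [_ inj _] _ _ hx hy txy; apply: inj => //; by rewrite inE /= in_itv.
Qed.

Lemma additive_generator_ge0 (R : realType) (T : R -> R -> R)
    (tau : R -> \bar R) (x : R) :
  additive_generator T tau -> 0 <= x <= 1 -> (0 <= tau x)%E.
Proof. by case=> _ _ [fun_ _ _] _ _ hx; apply: fun_; rewrite /= in_itv. Qed.

Lemma unit_invK (R : realType) (T : R -> R -> R) (tau : R -> \bar R)
    (y : \bar R) :
  additive_generator T tau -> (0 <= y)%E -> tau (unit_inv tau y) = y.
Proof.
by case=> _ _ [_ _ surj] _ _ hy; apply: (surjpK _ surj); rewrite inE.
Qed.

Lemma unit_inv_itv (R : realType) (T : R -> R -> R) (tau : R -> \bar R)
    (y : \bar R) :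
  additive_generator T tau -> (0 <= y)%E -> 0 <= unit_inv tau y <= 1.
Proof.
case=> _ _ bij _ _ hy.
have [+ _ _] := bijpinv_bij (fun=> 0) bij.
by move=> /(_ y hy); rewrite /= in_itv.
Qed.

(** [zeta tau] is [tau] precomposed with the involution [x => 1 - x], so its inverse applies that
    involution last. This removes [zeta] from the power of a PFN. *)
Lemma unit_inv_zeta (R : realType) (T : R -> R -> R) (tau : R -> \bar R)
    (y : \bar R) :
  additive_generator T tau -> (0 <= y)%E ->
  unit_inv (zeta tau) y = 1 - unit_inv tau y.
Proof.
move=> gen hy.
have hi := unit_inv_itv gen hy.
have -> : y = zeta tau (1 - unit_inv tau y).
  by rewrite /zeta subKr (unit_invK gen).
rewrite /unit_inv pinvKV.
- by rewrite /zeta subKr -/(unit_inv _ _) (unit_invK gen).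
- move=> u v; rewrite !inE /= !in_itv /= => hu hv.
  move=> /(additive_generator_inj gen) E.
  have : 1 - u = 1 - v by apply: E; lra.
  by lra.
- by rewrite inE /= in_itv /= -/(unit_inv _ _); lra.
Qed.

(** * Powers with respect to [T] *)

Definition tnorm_pow {R : realType} (tau : R -> \bar R) (l x : R) : R :=
  unit_inv tau (l%:E * tau x)%E.

Lemma pf_powE (R : realType) (T : R -> R -> R) (tau : R -> \bar R)
    (a : triple R) (l : R) :
  additive_generator T tau -> is_pfn a -> 0 <= l ->
  pf_pow tau a l = Triple (tnorm_pow tau l (mu a))
    (tnorm_pow tau l (eta a + mu a) - tnorm_pow tau l (mu a))
    (1 - tnorm_pow tau l (1 - nu a)).
Proof.
move=> gen [_ _ + _] l0; rewrite in_itv /= => hn.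
rewrite /pf_pow (unit_inv_zeta gen)//.
by rewrite mule_ge0 ?lee_fin// (additive_generator_ge0 gen)//; lra.
Qed.

Lemma mule_generator_ge0 (R : realType) (T : R -> R -> R) (tau : R -> \bar R)
    (l x : R) :
  additive_generator T tau -> 0 <= l -> 0 <= x <= 1 ->
  (0 <= l%:E * tau x)%E.
Proof.
move=> gen l0 hx.
by rewrite mule_ge0 ?lee_fin// (additive_generator_ge0 gen).
Qed.

Lemma tnorm_pow_itv (R : realType) (T : R -> R -> R) (tau : R -> \bar R)
    (l x : R) :
  additive_generator T tau -> 0 <= l -> 0 <= x <= 1 ->
  0 <= tnorm_pow tau l x <= 1.
Proof.
move=> gen l0 hx; apply: (unit_inv_itv gen).
exact: mule_generator_ge0 gen _ _.
Qed.

Lemma tnorm_pow1 (R : realType) (T : R -> R -> R) (tau : R -> \bar R)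
    (x : R) :
  additive_generator T tau -> 0 <= x <= 1 -> tnorm_pow tau 1 x = x.
Proof.
move=> gen hx; have t0 := additive_generator_ge0 gen hx.
apply: (additive_generator_inj gen) => //.
- exact: tnorm_pow_itv gen _ _.
- by rewrite /tnorm_pow mul1e (unit_invK gen).
Qed.

Lemma tnorm_pow0 (R : realType) (T : R -> R -> R) (tau : R -> \bar R)
    (x : R) :
  additive_generator T tau -> 0 <= x <= 1 -> tnorm_pow tau 0 x = 1.
Proof.
move=> gen hx; have [_ _ _ [t1 _] _] := gen.
apply: (additive_generator_inj gen) => //.
- exact: tnorm_pow_itv gen _ _.
- by rewrite ler01 lexx.
(* The convention [0 * +oo = 0] covers [x = 0], where [tau x = +oo]. *)
- by rewrite /tnorm_pow mul0e (unit_invK gen).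
Qed.

Lemma tnorm_powM (R : realType) (T : R -> R -> R) (tau : R -> \bar R)
    (l k x : R) :
  additive_generator T tau -> 0 <= k -> 0 <= x <= 1 ->
  tnorm_pow tau l (tnorm_pow tau k x) = tnorm_pow tau (l * k) x.
Proof.
move=> gen k0 hx; rewrite {1}/tnorm_pow (unit_invK gen) ?muleA//.
exact: mule_generator_ge0 gen _ _.
Qed.

Lemma tnorm_powD (R : realType) (T : R -> R -> R) (tau : R -> \bar R)
    (l k x : R) :
  additive_generator T tau -> 0 <= l -> 0 <= k -> 0 <= x <= 1 ->
  T (tnorm_pow tau l x) (tnorm_pow tau k x) = tnorm_pow tau (l + k) x.
Proof.
move=> gen l0 k0 hx; have [_ _ _ _ TE] := gen.
rewrite TE ?in_itv /= ?(tnorm_pow_itv gen)//.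
rewrite !(unit_invK gen) ?(mule_generator_ge0 gen)//.
(* Distributivity survives an infinite [tau x] because [l] and [k] are both nonnegative. *)
by rewrite /tnorm_pow EFinD ge0_muleDl ?lee_fin.
Qed.

Lemma ler_tnorm_pow (R : realType) (T : R -> R -> R) (tau : R -> \bar R)
    (l x y : R) :
  additive_generator T tau -> 0 <= l -> 0 <= x -> x <= y -> y <= 1 ->
  tnorm_pow tau l x <= tnorm_pow tau l y.
Proof.
move=> gen l0 x0 xy y1; have [_ dec _ _ _] := gen.
have hx : 0 <= x <= 1 by lra.
have hy : 0 <= y <= 1 by lra.
have tauxy : (tau y <= tau x)%E.
  move: xy; rewrite le_eqVlt => /orP[/eqP -> //|xy].
  by apply/ltW/dec; rewrite ?in_itv.
(* If the powers were in the opposite strict order, strict decrease of [tau] would give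
   [l * tau x < l * tau y], against [tauxy]. *)
rewrite leNgt; apply/negP => /dec.
rewrite !in_itv /= !(tnorm_pow_itv gen)// => /(_ isT isT).
rewrite !(unit_invK gen) ?(mule_generator_ge0 gen)// ltNge.
by rewrite lee_wpmul2l// lee_fin.
Qed.

(** * Powers of PFNs *)

Lemma is_pfn_pow (R : realType) (T : R -> R -> R) (tau : R -> \bar R)
    (a : triple R) (l : R) :
  additive_generator T tau -> is_pfn a -> 0 <= l -> is_pfn (pf_pow tau a l).
Proof.
move=> gen ha l0; rewrite (pf_powE gen ha l0).
case: a ha => m e v [/=]; rewrite !in_itv /= => hm he hv h.
have hem : 0 <= e + m <= 1 by lra.
have hv' : 0 <= 1 - v <= 1 by lra.
have := tnorm_pow_itv gen l0 hm; have := tnorm_pow_itv gen l0 hem.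
have := tnorm_pow_itv gen l0 hv'.
(* Being a PFN amounts to the chain [0 <= m <= e + m <= 1 - v <= 1], whose inner links are preserved
   by monotonicity of the power. *)
have := @ler_tnorm_pow _ _ _ l m (e + m) gen l0.
have := @ler_tnorm_pow _ _ _ l (e + m) (1 - v) gen l0.
move=> /(_ ltac:(lra) ltac:(lra) ltac:(lra)) h1.
move=> /(_ ltac:(lra) ltac:(lra) ltac:(lra)) h2 i1 i2 i3.
by split; rewrite /= ?in_itv /=; lra.
Qed.

Lemma pf_pow1 (R : realType) (T : R -> R -> R) (tau : R -> \bar R)
    (a : triple R) :
  additive_generator T tau -> is_pfn a -> pf_pow tau a 1 = a.
Proof.
move=> gen ha; rewrite (pf_powE gen ha ler01).
case: a ha => m e v [/=]; rewrite !in_itv /= => hm he hv h.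
by rewrite !(tnorm_pow1 gen); [congr Triple; lra|lra..].
Qed.

(** The dual of this value is [pf_zero], so the exponent 0 accounts for the empty iterated sum. *)
Lemma pf_pow0 (R : realType) (T : R -> R -> R) (tau : R -> \bar R)
    (a : triple R) :
  additive_generator T tau -> is_pfn a -> pf_pow tau a 0 = Triple 1 0 0.
Proof.
move=> gen ha; rewrite (pf_powE gen ha (lexx 0)).
case: a ha => m e v [/=]; rewrite !in_itv /= => hm he hv h.
by rewrite !(tnorm_pow0 gen); [congr Triple; lra|lra..].
Qed.

Lemma pf_powM (R : realType) (T : R -> R -> R) (tau : R -> \bar R)
    (a : triple R) (k l : R) :
  additive_generator T tau -> is_pfn a -> 0 <= k -> 0 <= l ->
  pf_pow tau (pf_pow tau a k) l = pf_pow tau a (l * k).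
Proof.
move=> gen ha k0 l0; rewrite (pf_powE gen (is_pfn_pow gen ha k0) l0).
rewrite !(pf_powE gen ha) ?mulr_ge0//=.
case: a ha => m e v [/=]; rewrite !in_itv /= => hm he hv h.
by rewrite subrK subKr !(tnorm_powM _ gen)//; lra.
Qed.

Lemma pf_powD (R : realType) (T : R -> R -> R) (tau : R -> \bar R)
    (a : triple R) (k l : R) :
  additive_generator T tau -> is_pfn a -> 0 <= k -> 0 <= l ->
  pf_mul T (pf_pow tau a k) (pf_pow tau a l) = pf_pow tau a (k + l).
Proof.
move=> gen ha k0 l0; rewrite !(pf_powE gen ha) ?addr_ge0// /pf_mul /tconorm /=.
case: a ha => m e v [/=]; rewrite !in_itv /= => hm he hv h.
by rewrite !subrK !subKr !(tnorm_powD gen)//; lra.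
Qed.

(** * Scalar multiples by duality *)

Definition pf_dual {R : realType} (a : triple R) : triple R :=
  Triple (nu a) (eta a) (mu a).

Lemma is_pfn_dual (R : realType) (a : triple R) :
  is_pfn a -> is_pfn (pf_dual a).
Proof. by case=> hm he hv h; split=> //=; lra. Qed.

Lemma pf_scaleE (R : realType) (tau : R -> \bar R) (l : R) (a : triple R) :
  pf_scale tau l a = pf_dual (pf_pow tau (pf_dual a) l).
Proof. by []. Qed.

Lemma pf_scaleDl (R : realType) (T : R -> R -> R) (tau : R -> \bar R)
    (a : triple R) (k l : R) :
  additive_generator T tau -> is_pfn a -> 0 <= k -> 0 <= l ->
  pf_add T (pf_scale tau k a) (pf_scale tau l a) = pf_scale tau (k + l) a.
Proof.
move=> gen ha k0 l0.
(* The dual of the power law is the goal up to conversion: exchanging [mu] and [nu] turns the body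
   of [pf_mul] into that of [pf_add]. *)
by have /(congr1 pf_dual) := pf_powD gen (is_pfn_dual ha) k0 l0.
Qed.

Lemma pf_scale_suml (R : realType) (T : R -> R -> R) (tau : R -> \bar R)
    (a : triple R) (I : finType) (P : pred I) (c : I -> R) :
  additive_generator T tau -> is_pfn a -> (forall i, 0 <= c i) ->
  \big[pf_add T/pf_zero R]_(i | P i) pf_scale tau (c i) a =
  pf_scale tau (\sum_(i | P i) c i) a.
Proof.
move=> gen ha c0.
(* The induction also carries nonnegativity of the partial sums, which [pf_scaleDl] requires of its
   second scalar. *)
suff [] : 0 <= \sum_(i | P i) c i /\
    \big[pf_add T/pf_zero R]_(i | P i) pf_scale tau (c i) a =
    pf_scale tau (\sum_(i | P i) c i) a by [].
elim/big_rec2: _ => [|i s t _ [s0 ->]].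
  by rewrite pf_scaleE (pf_pow0 gen (is_pfn_dual ha)).
by rewrite addr_ge0// (pf_scaleDl gen).
Qed.

(** * Weights of the Bonferroni mean *)

Lemma weight_lt1 (R : realType) (n : nat) (omega : 'I_n -> R)
    (i : 'I_n) :
  (2 <= n)%N -> (forall j, 0 < omega j) -> \sum_(j < n) omega j = 1 ->
  omega i < 1.
Proof.
case: n omega i => [|[|n]]// omega i _ w0 <-.
(* As [n >= 2], there is an index [j] other than [i]; its positive weight keeps [omega i] strictly
   below the total. *)
pose j := lift i ord0; have ji : j != i by rewrite eq_sym neq_lift.
rewrite (bigD1 i)//= (bigD1 j)//= ltrDl ltr_pwDl// sumr_ge0// => k _.
exact: ltW.
Qed.

(** For fixed [i], the weights of the other indices add up to [1 - omega i], which cancels the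
    nonzero denominator and leaves [omega i]. *)
Lemma bonferroni_weight_sum (R : realType) (n : nat) (omega : 'I_n -> R) :
  (forall i, omega i < 1) -> \sum_(i < n) omega i = 1 ->
  \sum_(ij : 'I_n * 'I_n | ij.1 != ij.2)
    omega ij.1 * omega ij.2 / (1 - omega ij.1) = 1.
Proof.
move=> w1 sum1.
rewrite -(pair_big_dep xpredT (fun i j => i != j)
  (fun i j => omega i * omega j / (1 - omega i)))/=.
rewrite -[RHS]sum1; apply: eq_bigr => i _.
rewrite -mulr_suml -mulr_sumr.
have -> : \sum_(j < n | i != j) omega j = 1 - omega i.
  rewrite -sum1 [in RHS](bigD1 i)//= addrAC subrr add0r.
  by apply: eq_bigl => j; rewrite eq_sym.
by rewrite mulfK// subr_eq0 eq_sym lt_eqF.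
Qed.

Theorem theoremV5 (R : realType) (n : nat) (alpha : 'I_n -> triple R)
    (omega : 'I_n -> R) (T : R -> R -> R) (tau : R -> \bar R) (a : triple R)
    (p q : R) :
  (2 <= n)%N ->
  (forall i, is_pfn (alpha i)) ->
  (forall i, omega i \in `]0, 1]) ->
  \sum_(i < n) omega i = 1 ->
  strict_tnorm T ->
  additive_generator T tau ->
  (forall i, alpha i = a) ->
  0 < p -> 0 < q ->
  PFINWBM T tau p q omega alpha = a.
Proof.
move=> n2 pfn_alpha w01 sum1 _ gen alphaE p0 q0.
have w0 i : 0 < omega i by have := w01 i; rewrite in_itv => /andP[].
have w1 i : omega i < 1 by exact: weight_lt1.
(* [n2] unfolds to [1 < n], so [Ordinal n2] is the index 1, a witness that some [alpha i] equals
   [a]. *)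
have ha : is_pfn a by rewrite -(alphaE (Ordinal n2)).
have pq0 : 0 < p + q by rewrite addr_gt0.
have hb : is_pfn (pf_pow tau a (p + q)) := is_pfn_pow gen ha (ltW pq0).
rewrite /PFINWBM; under eq_bigr do
  rewrite !alphaE (pf_powD gen ha (ltW p0) (ltW q0)).
rewrite (pf_scale_suml _ gen hb); last first.
  by move=> ij; rewrite divr_ge0 ?mulr_ge0 ?subr_ge0 ?ltW.
rewrite bonferroni_weight_sum// pf_scaleE (pf_pow1 gen (is_pfn_dual hb)).
(* The two duals cancel by computation, since [pf_pow] unfolds to a [Triple]. *)
rewrite (_ : pf_dual _ = pf_pow tau a (p + q))//.
rewrite (pf_powM gen ha) ?divr_ge0 ?ltW//.
by rewrite mulfVK ?gt_eqF// (pf_pow1 gen).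
Qed.
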